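(* Let $f$ be a non-negative monotone set function on $[n]$ whose multilinear extension $F$ is one-sided $\sigma$-smooth. Let $P\subseteq[0,1]^n$ be a polytime separable downward-closed polytope, $\alpha\in[0,1)$, and assume $F$ satisfies a $\mu$ bound for some $\mu=\mu(\alpha,\sigma)\in(0,1]$. Then the output of the discrete jump-start continuous greedy algorithm with step size $\delta\le\min\{\frac{1-\alpha}{n^3},\frac{1}{(1-\alpha)\mu}\}$ (with $1/\delta$ an integer) satisfies \[ F(x^1)\ge\big(1-\exp(-\tfrac12(1-\alpha)\mu)\big)(1-o(1))\,OPT, \] where $OPT=\max_{x\in P}F(x)$ and $o(1)\to0$ as $n\to\infty$.
   Context: The multilinear extension of $f$ is $F(x)=\mathbb E[f(R(x))]$, with $R(x)$ containing each $i$ independently with probability $x_i$. $f$ monotone: $S\subseteq T\Rightarrow f(S)\le f(T)$. One-sided $\sigma$-smooth: $\frac12u^T\nabla^2F(x)u\le\sigma\frac{\|u\|_1}{\|x\|_1}u^T\nabla F(x)$ for all $u,x\ge0$, $x\ne0$. Let $v^*\in\arg\max_{x\in P}\|x\|_1$, $v_{max}(x)\in\arg\max_{v\in P}v^T\nabla F(x)$. $\mu$ bound: $v_{max}(x)\cdot\nabla F(x)\ge\mu(OPT-F(x))$ for all $x\in P$ with $x\ge\alpha v^*$. Discrete algorithm: $x^0=\alpha v^*$, $x^{t+\delta}=x^t+\delta(1-\alpha)v_{max}(x^t)$; output $x^1$. *)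

(* Defs.v *)
From HB Require Import structures.
From mathcomp Require Import all_boot all_order all_algebra.
From mathcomp Require Import all_classical all_reals all_analysis.

Set Implicit Arguments.
Unset Strict Implicit.
Unset Printing Implicit Defensive.
Import Order.TTheory GRing.Theory Num.Theory.
Import numFieldNormedType.Exports.

Local Open Scope classical_set_scope.
Local Open Scope ring_scope.

Section Vectors.
Context {R : realType} {n : nat}.
Implicit Types (x y u v : 'rV[R]_n) (P : set 'rV[R]_n).

Definition dot u v : R := \sum_i u 0 i * v 0 i.

(* The library's norm on row vectors is the sup norm, hence this one. *)
Definition norm1 x : R := \sum_i `|x 0 i|.

Definition le_vec x y : Prop := forall i, x 0 i <= y 0 i.

Definition unit_cube : set 'rV[R]_n := [set x | forall i, 0 <= x 0 i <= 1].

Definition is_polytope P : Prop :=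
  bounded_set P /\
  exists (m : nat) (A : 'M[R]_(m, n)) (b : 'cV[R]_m),
    P = [set x | forall k, (A *m x^T) k 0 <= b k 0].

Definition downward_closed P : Prop :=
  forall x y, P x -> le_vec 0 y -> le_vec y x -> P y.

Definition is_argmax P (g : 'rV[R]_n -> R) x : Prop :=
  P x /\ forall y, P y -> g y <= g x.

Definition is_max P (g : 'rV[R]_n -> R) (m : R) : Prop :=
  exists2 x, is_argmax P g x & g x = m.

Definition grad (F : 'rV[R]_n -> R) x : 'rV[R]_n :=
  \row_i 'D_(delta_mx 0 i) F x.

Definition hessian (F : 'rV[R]_n -> R) x : 'M[R]_n :=
  \matrix_(i, j) 'D_(delta_mx 0 i) (fun y => 'D_(delta_mx 0 j) F y) x.

(* The points x range over the nonzero points of [0,1]^n, where a multilinear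
   extension is defined. *)
Definition one_sided_smooth (sigma : R) (F : 'rV[R]_n -> R) : Prop :=
  forall x u, unit_cube x -> x != 0 -> le_vec 0 u ->
    2^-1 * (u *m hessian F x *m u^T) 0 0
      <= sigma * (norm1 u / norm1 x) * dot u (grad F x).

End Vectors.

Section SetFunctions.
Context {R : realType} {n : nat}.
Implicit Types (f : {set 'I_n} -> R) (x : 'rV[R]_n) (S T : {set 'I_n}).

Definition nonneg_setfun f : Prop := forall S, 0 <= f S.

Definition monotone_setfun f : Prop := forall S T, S \subset T -> f S <= f T.

(* Probability that R(x) = S, when R(x) contains each i independently with
   probability x_i. *)
Definition prob_random_set x S : R :=
  (\prod_(i in S) x 0 i) * (\prod_(i in ~: S) (1 - x 0 i)).

(* E[f(R(x))]; outside [0,1]^n this is the same polynomial, so derivatives on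
   the boundary of the cube make sense. *)
Definition multilinear_ext f x : R := \sum_S prob_random_set x S * f S.

End SetFunctions.

Section JumpStartGreedy.
Context {R : realType} {n : nat}.

Definition mu_bound (P : set 'rV[R]_n) (F : 'rV[R]_n -> R) (alpha mu OPT : R)
    (vstar : 'rV[R]_n) (vmax : 'rV[R]_n -> 'rV[R]_n) : Prop :=
  forall x, P x -> le_vec (alpha *: vstar) x ->
    mu * (OPT - F x) <= dot (vmax x) (grad F x).

(* jump_start_greedy k is the iterate x^t at time t = k * delta. *)
Definition jump_start_greedy (alpha delta : R) (vstar : 'rV[R]_n)
    (vmax : 'rV[R]_n -> 'rV[R]_n) (k : nat) : 'rV[R]_n :=
  iter k (fun x => x + (delta * (1 - alpha)) *: vmax x) (alpha *: vstar).

End JumpStartGreedy.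

(* Main.v *)
(** A multilinear extension is affine in each coordinate, so a greedy step can
be carried out one coordinate at a time, each move gaining exactly (increment)
x (partial derivative at the current point).  The partial derivatives are
non-negative combinations of the weights [prod_(j in S) x_j prod_(j notin S)
(1 - x_j)]; when [x] increases to [z], such a weight can only shrink through
the factors [1 - x_j].  Before time [2/3] all coordinates satisfy
[1 - x_j >= (1 - alpha) / 3], so one step shrinks each of these factors by at
most [1 - 3 delta], hence each weight by at most [(1 - 3 delta)^n >= 3/4] once
[n >= 4].  Up to time [2/3] the gap [OPT - F] thus contracts by
[1 - 3/4 delta (1 - alpha) mu] per step, which accumulates to at most
[exp (- (1 - alpha) mu / 2)], and by monotonicity the remaining steps do no
harm.  The error term therefore vanishes for [n >= 4]. *)
Require Import Defs.
From HB Require Import structures.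
From mathcomp Require Import all_boot all_order all_algebra.
From mathcomp Require Import all_classical all_reals all_analysis.
From mathcomp Require Import zify ring lra.
Import Order.TTheory GRing.Theory Num.Theory.
Import numFieldNormedType.Exports.
Local Open Scope classical_set_scope.
Local Open Scope ring_scope.

(** * Partial derivatives and increments of the multilinear extension *)

Section MultilinearExtension.
Context {R : realType} {n : nat}.
Implicit Types (f : {set 'I_n} -> R) (x y z h : 'rV[R]_n) (S : {set 'I_n}).

(** For [i \notin S], the probability that [R(x)] with [i] removed equals [S]; the coordinate
    [x 0 i] does not occur in it. *)
Definition prob_without (i : 'I_n) x S : R :=
  (\prod_(j in S) x 0 j) * (\prod_(j in ~: (i |: S)) (1 - x 0 j)).

(** The expected marginal value of [i] over the random set drawn from the other elements. *)
Definition multilinear_partial f (i : 'I_n) x : R :=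
  \sum_(S : {set 'I_n} | i \notin S) prob_without i x S * (f (i |: S) - f S).

Lemma prob_random_set_notin (i : 'I_n) x S : i \notin S ->
  prob_random_set x S = (1 - x 0 i) * prob_without i x S.
Proof.
move=> iS; rewrite /prob_random_set /prob_without [X in _ * X](bigD1 i) /=; last first.
  by rewrite inE iS.
rewrite mulrCA; congr (_ * (_ * _)); apply: eq_bigl => j.
by rewrite !inE negb_or andbC.
Qed.

Lemma prob_random_set_setU1 (i : 'I_n) x S : i \notin S ->
  prob_random_set x (i |: S) = x 0 i * prob_without i x S.
Proof. by move=> iS; rewrite /prob_random_set big_setU1 //= -mulrA. Qed.

Lemma prob_without_congr (i : 'I_n) x y S : i \notin S ->
  (forall j, j != i -> x 0 j = y 0 j) -> prob_without i x S = prob_without i y S.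
Proof.
move=> iS xy; congr (_ * _); apply: eq_bigr => j.
  by move=> jS; rewrite xy //; apply: contraNneq iS => <-.
by rewrite !inE negb_or => /andP[ji _]; rewrite xy.
Qed.

(** Condition on whether [i] is drawn, pairing each [S] that avoids [i] with [i |: S]. Neither sum
    on the right involves [x 0 i], so the extension is affine in that coordinate. *)
Lemma multilinear_ext_split f (i : 'I_n) x :
  multilinear_ext f x =
  \sum_(S : {set 'I_n} | i \notin S) prob_without i x S * f S
    + x 0 i * multilinear_partial f i x.
Proof.
rewrite /multilinear_ext (bigID (fun S : {set 'I_n} => i \in S)) /=.
rewrite (reindex_onto (fun S => i |: S) (fun S => S :\ i)) /=; last first.
  by move=> S iS; rewrite finset.setD1K.
rewrite (eq_bigl (fun S : {set 'I_n} => i \notin S)); last first.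
  move=> S; rewrite finset.setU11 /=; apply/eqP/idP => [<-|iS]; last by rewrite finset.setU1K.
  by rewrite !inE eqxx.
rewrite -big_split /= /multilinear_partial mulr_sumr -big_split /=.
apply: eq_bigr => S iS.
by rewrite prob_random_set_setU1 // (prob_random_set_notin i) //; ring.
Qed.

Lemma multilinear_ext_shift f (i : 'I_n) x y (t : R) :
  (forall j, j != i -> y 0 j = x 0 j) -> y 0 i = x 0 i + t ->
  multilinear_ext f y = multilinear_ext f x + t * multilinear_partial f i x.
Proof.
move=> yx yi; rewrite !(multilinear_ext_split f i) yi.
have qE S : i \notin S -> prob_without i y S = prob_without i x S.
  by move=> iS; exact: prob_without_congr.
have -> : multilinear_partial f i y = multilinear_partial f i x.
  by apply: eq_bigr => S iS; rewrite qE.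
have -> : \sum_(S : {set 'I_n} | i \notin S) prob_without i y S * f S =
          \sum_(S : {set 'I_n} | i \notin S) prob_without i x S * f S.
  by apply: eq_bigr => S iS; rewrite qE.
by ring.
Qed.

(** By affinity the difference quotient is constant for [t != 0], so its limit is that constant at
    every point. *)
Lemma grad_multilinear_ext f x (i : 'I_n) :
  grad (multilinear_ext f) x 0 i = multilinear_partial f i x.
Proof.
rewrite mxE /derive; apply: cvg_lim => //.
apply: cvg_near_cst; near=> t.
have t0 : t != 0 by near: t; exact: nbhs_dnbhs_neq.
rewrite /= (multilinear_ext_shift f i x _ t).
- by rewrite addrAC subrr add0r /GRing.scale /= mulKf.
- by move=> j ji; rewrite !mxE (negPf ji) andbF mulr0 add0r.
- by rewrite !mxE !eqxx mulr1 addrC.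
Unshelve. all: by end_near. Qed.

Lemma prob_without_ge0 (i : 'I_n) x S : unit_cube x -> 0 <= prob_without i x S.
Proof.
move=> x01; apply: mulr_ge0; apply: prodr_ge0 => j _.
  by have /andP[] := x01 j.
by rewrite subr_ge0; have /andP[] := x01 j.
Qed.

Lemma multilinear_partial_ge0 f (i : 'I_n) x : monotone_setfun f ->
  unit_cube x -> 0 <= multilinear_partial f i x.
Proof.
move=> fm x01; apply: sumr_ge0 => S _; apply: mulr_ge0.
  exact: prob_without_ge0.
by rewrite subr_ge0; apply: fm; exact: finset.subsetU1.
Qed.

Lemma multilinear_ext_ge0 f x : nonneg_setfun f -> unit_cube x ->
  0 <= multilinear_ext f x.
Proof.
move=> f0 x01; apply: sumr_ge0 => S _; apply: mulr_ge0 => //.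
apply: mulr_ge0; apply: prodr_ge0 => j _; first by have /andP[] := x01 j.
by rewrite subr_ge0; have /andP[] := x01 j.
Qed.

(** In each weight the factors [x 0 j] only grow, and at most [n] factors [1 - x 0 j] lose a ratio
    of at most [1 - p] each. Monotonicity makes the marginal values multiplying the weights
    non-negative. *)
Lemma multilinear_partial_shrink f (i : 'I_n) x z (p : R) :
  monotone_setfun f -> 0 <= p <= 1 -> unit_cube x -> unit_cube z ->
  le_vec x z -> (forall j, (1 - p) * (1 - x 0 j) <= 1 - z 0 j) ->
  (1 - p) ^+ n * multilinear_partial f i x <= multilinear_partial f i z.
Proof.
move=> fm /andP[p0 p1] x01 z01 xz pxz.
rewrite /multilinear_partial mulr_sumr; apply: ler_sum => S iS.
rewrite mulrA ler_wpM2r //; first by rewrite subr_ge0; apply: fm; exact: finset.subsetU1.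
rewrite /prob_without mulrCA.
have x0 j : 0 <= x 0 j by have /andP[] := x01 j.
have x1 j : 0 <= 1 - x 0 j by rewrite subr_ge0; have /andP[] := x01 j.
apply: ler_pM.
- exact: prodr_ge0.
- by rewrite mulr_ge0 ?exprn_ge0 ?subr_ge0 // prodr_ge0.
- by apply: ler_prod => j _; rewrite x0 xz.
have A0 (A : {set 'I_n}) :
    (1 - p) ^+ #|A| * \prod_(j in A) (1 - x 0 j) <= \prod_(j in A) (1 - z 0 j).
  rewrite -prodr_const -big_split /=; apply: ler_prod => j _.
  by rewrite pxz mulr_ge0 ?subr_ge0 // -subr_ge0.
apply: le_trans (A0 _); apply: ler_wpM2r; first exact: prodr_ge0.
apply: ler_wiXn2l; rewrite ?subr_ge0 ?gerBl //.
by rewrite -[leqRHS](card_ord n) max_card.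
Qed.

(* Coordinates are moved one after the other, [z k] being the point at which
   the first [k] of them have been moved. *)
Lemma multilinear_ext_increment f x h (c : R) :
  le_vec 0 h ->
  (forall i z, le_vec x z -> le_vec z (x + h) ->
     c * multilinear_partial f i x <= multilinear_partial f i z) ->
  c * \sum_i h 0 i * multilinear_partial f i x <=
  multilinear_ext f (x + h) - multilinear_ext f x.
Proof.
move=> h0 hc.
have h_ge0 j : 0 <= h 0 j by have := h0 j; rewrite mxE.
pose z (k : nat) : 'rV[R]_n := \row_j (x 0 j + (if (j < k)%N then h 0 j else 0)).
have step k : (k <= n)%N ->
    c * \sum_(i < n | (i < k)%N) h 0 i * multilinear_partial f i x <=
    multilinear_ext f (z k) - multilinear_ext f x.
  elim: k => [_|k IH kn].
    rewrite big_pred0 // mulr0; suff -> : z 0%N = x by rewrite subrr.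
    by apply/rowP => j; rewrite mxE addr0.
  pose i := Ordinal kn.
  rewrite (bigD1 i) //= (eq_bigl (fun j : 'I_n => (j < k)%N)); last first.
    by move=> j; rewrite -(inj_eq val_inj) /=; lia.
  rewrite (multilinear_ext_shift f i (z k) (z k.+1) (h 0 i)).
  - have xz : le_vec x (z k) by move=> j; rewrite mxE lerDl; case: ifP.
    have zh : le_vec (z k) (x + h).
      by move=> j; rewrite !mxE lerD2l; case: ifP.
    have := ler_wpM2l (h_ge0 i) (hc i _ xz zh).
    by have := IH (ltnW kn); lra.
  - move=> j; rewrite -(inj_eq val_inj) /= => ji; rewrite !mxE.
    by have -> : (j < k.+1)%N = (j < k)%N by lia.
  - by rewrite !mxE /= ltnSn ltnn addr0.
have := step n (leqnn n); congr (c * _ <= multilinear_ext f _ - _).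
  by apply: eq_bigl => j; rewrite ltn_ord.
by apply/rowP => j; rewrite !mxE ltn_ord.
Qed.

Lemma multilinear_ext_homo f x h : monotone_setfun f -> le_vec 0 h ->
  unit_cube x -> unit_cube (x + h) ->
  multilinear_ext f x <= multilinear_ext f (x + h).
Proof.
move=> fm h0 x01 y01; rewrite -subr_ge0.
(* With [c = 0], only the sign of the partial derivatives between the two points matters. *)
apply: le_trans (multilinear_ext_increment f x h 0 h0 _).
  by rewrite mul0r.
move=> i z xz zy; rewrite mul0r; apply: multilinear_partial_ge0 => // j.
have /andP[xj0 _] := x01 j; have /andP[_ yj1] := y01 j.
by rewrite (le_trans xj0 (xz j)) (le_trans (zy j) yj1).
Qed.

(** As [v 0 j <= 1], every [z] between [x] and [x + e *: v] has [1 - z 0 j >= 1 - x 0 j - e >= (1 -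
    p) * (1 - x 0 j)], which is what [multilinear_partial_shrink] asks for. *)
Lemma multilinear_ext_step f x v (e p : R) : monotone_setfun f ->
  0 <= p <= 1 -> 0 <= e -> unit_cube v -> unit_cube x -> unit_cube (x + e *: v) ->
  (forall j, e <= p * (1 - x 0 j)) ->
  (1 - p) ^+ n * (e * dot v (grad (multilinear_ext f) x)) <=
  multilinear_ext f (x + e *: v) - multilinear_ext f x.
Proof.
move=> fm p01 e0 v01 x01 y01 ep.
have h0 : le_vec 0 (e *: v).
  by move=> j; rewrite !mxE mulr_ge0 //; have /andP[] := v01 j.
apply: le_trans (multilinear_ext_increment f x (e *: v) ((1 - p) ^+ n) h0 _).
  rewrite /dot mulr_sumr le_eqVlt; apply/orP; left; apply/eqP; congr (_ * _).
  by apply: eq_bigr => i _; rewrite grad_multilinear_ext mxE mulrA.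
move=> i z xz zy; apply: multilinear_partial_shrink => // j.
  have /andP[xj0 _] := x01 j; have /andP[_ yj1] := y01 j.
  by rewrite (le_trans xj0 (xz j)) (le_trans (zy j) yj1).
have /andP[vj0 vj1] := v01 j.
have := zy j; have := ep j; rewrite !mxE.
by have := ler_wpM2l e0 vj1; lra.
Qed.

End MultilinearExtension.

(** * Feasibility of the iterates *)

Section Iterates.
Context {R : realType} {n : nat}.
Variables (P : set 'rV[R]_n) (vstar : 'rV[R]_n) (vmax : 'rV[R]_n -> 'rV[R]_n).
Variables (alpha delta : R).
Hypotheses (Ppoly : is_polytope P) (Pcube : P `<=` unit_cube).
Hypotheses (Pdown : downward_closed P) (alpha01 : 0 <= alpha < 1).
Hypotheses (Pvstar : P vstar) (Pvmax : forall x, P x -> P (vmax x)).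
Hypothesis delta_gt0 : 0 < delta.

Let x := jump_start_greedy alpha delta vstar vmax.
Let load (k : nat) : R := alpha + k%:R * (delta * (1 - alpha)).

Let loadS k : load k.+1 = load k + delta * (1 - alpha).
Proof. by rewrite /load -natr1; ring. Qed.

Let load_le1 k : k%:R * delta <= 1 -> load k <= 1.
Proof.
case/andP: alpha01 => a0 a1 kd; rewrite /load mulrA.
have : 0 <= 1 - alpha by lra.
by move/(ler_wpM2r)/(_ _ _ kd); lra.
Qed.

Lemma jump_start_greedyS k :
  x k.+1 = x k + (delta * (1 - alpha)) *: vmax (x k).
Proof. by []. Qed.

(* Writing [P] as [A x <= b] with [b >= 0], the [k]-th iterate lies in [load k]
   times [P], where [load k <= 1]. *)
Lemma jump_start_greedy_mem k : k%:R * delta <= 1 ->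
  [/\ P (x k), le_vec (alpha *: vstar) (x k) &
      forall j, x k 0 j <= alpha + k%:R * (delta * (1 - alpha))].
Proof.
case: Ppoly => _ [m [A [b PE]]]; case/andP: (alpha01) => a0 a1.
have e0 : 0 <= delta * (1 - alpha) by rewrite mulr_ge0 ?subr_ge0 // ltW.
(* The origin lies in [P] by downward closure, which forces [b >= 0]; this is what turns
   [load k * b] into a bound by [b]. *)
have P0 : P 0.
  apply: (Pdown _ _ Pvstar) => j //; rewrite mxE.
  by have /andP[] := Pcube _ Pvstar j.
have PA y r : P y -> (A *m y^T) r 0 <= b r 0 by rewrite PE; exact.
have b0 r : 0 <= b r 0.
  by have := PA _ r P0; rewrite trmx0 mulmx0 mxE.
move=> kd.
suff [Ak vk uk] : [/\ forall r, (A *m (x k)^T) r 0 <= load k * b r 0,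
    le_vec (alpha *: vstar) (x k) & forall j, x k 0 j <= load k].
  split=> //; rewrite PE => r; apply: le_trans (Ak r) _.
  by rewrite ler_piMl // load_le1.
elim: k kd => [_|k IH kd].
  rewrite /load mul0r addr0 /x /=; split => // [r|j].
    by rewrite linearZ /= -scalemxAr mxE ler_wpM2l // PA.
  by rewrite mxE ler_piMr //; have /andP[] := Pcube _ Pvstar j.
have kd' : k%:R * delta <= 1.
  by apply: le_trans kd; rewrite ler_wpM2r ?ler_nat // ltW.
have [Ak vk uk] := IH kd'.
(* Membership of [x k] has to be recovered first, since [vmax] is only known to be feasible at
   points of [P]. *)
have Pk : P (x k).
  rewrite PE => r; apply: le_trans (Ak r) _.
  by rewrite ler_piMl // load_le1.
rewrite jump_start_greedyS loadS; split=> [r|j|j].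
- rewrite linearD linearZ /= mulmxDr -scalemxAr mxE mulrDl lerD //.
  by rewrite [leLHS]mxE ler_wpM2l // PA //; exact: Pvmax.
- rewrite [leRHS]mxE; apply: le_trans (vk j) _; rewrite lerDl mxE.
  by rewrite mulr_ge0 //; have /andP[] := Pcube _ (Pvmax _ Pk) j.
- rewrite mxE lerD // mxE ler_piMr //.
  by have /andP[] := Pcube _ (Pvmax _ Pk) j.
Qed.

End Iterates.

(** * Contraction of the gap to the optimum *)

Lemma bernoulli_le {R : realFieldType} (p : R) (n : nat) :
  0 <= p <= 1 -> 1 - n%:R * p <= (1 - p) ^+ n.
Proof.
case/andP=> p0 p1; elim: n => [|n IH]; first by rewrite mul0r subr0 expr0.
have q0 : 0 <= 1 - p by lra.
have := ler_wpM2l q0 IH; rewrite exprS -natr1.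
have : 0 <= n%:R * p ^+ 2 :> R by rewrite mulr_ge0 // exprn_ge0.
by lra.
Qed.

Theorem theorem10 (R : realType) :
  exists eps : nat -> R,
    (eps @ \oo --> (0 : R)) /\
    forall (n : nat) (f : {set 'I_n} -> R) (sigma alpha mu : R)
      (P : set 'rV[R]_n) (vstar : 'rV[R]_n) (vmax : 'rV[R]_n -> 'rV[R]_n)
      (OPT delta : R) (N : nat),
    let F := multilinear_ext f in
    nonneg_setfun f ->
    monotone_setfun f ->
    one_sided_smooth sigma F ->
    is_polytope P ->
    P `<=` unit_cube ->
    downward_closed P ->
    0 <= alpha < 1 ->
    0 < mu <= 1 ->
    is_argmax P norm1 vstar ->
    (forall x, P x -> is_argmax P (fun v => dot v (grad F x)) (vmax x)) ->
    is_max P F OPT ->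
    mu_bound P F alpha mu OPT vstar vmax ->
    0 < delta ->
    delta <= Num.min ((1 - alpha) / (n ^ 3)%:R) (1 / ((1 - alpha) * mu)) ->
    1 / delta = N%:R ->
    F (jump_start_greedy alpha delta vstar vmax N)
      >= (1 - expR (- (2^-1 * (1 - alpha) * mu))) * (1 - eps n) * OPT.
Proof.
(* The error is 1 for [n < 4], where the claim reduces to non-negativity of [F], and 0
   afterwards. *)
exists (fun n => (n < 4)%N%:R); split.
  apply: cvg_near_cst; near=> n.
  have : (4 <= n)%N by near: n; exact: nbhs_infty_ge.
  by rewrite leqNgt => /negPf ->.
move=> n f sigma alpha mu P vstar vmax OPT delta N F f0 fm _ Ppoly Pcube Pdown.
move=> a01 mu01 [Pvstar _] vmaxP [xopt [Pxopt optP] optE] muP d0 + dN.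
rewrite le_min => /andP[dn _].
have Nd : N%:R * delta = 1 by rewrite -dN mul1r mulVf // gt_eqF.
pose x := jump_start_greedy alpha delta vstar vmax.
have Pvmax y : P y -> P (vmax y) by move=> /vmaxP[].
have kdle k : (k <= N)%N -> k%:R * delta <= 1.
  by move=> kN; rewrite -[leRHS]Nd ler_wpM2r ?ler_nat // ltW.
have xP k (kN : (k <= N)%N) := jump_start_greedy_mem _ _ _ _ _ Ppoly Pcube Pdown
  a01 Pvstar Pvmax d0 _ (kdle _ kN).
rewrite -/(x N).
have Px k : (k <= N)%N -> P (x k) by move=> /xP[].
have [n4|n4] := ltnP n 4.
  rewrite subrr mulr0 mul0r; apply: multilinear_ext_ge0 => //.
  exact/Pcube/Px.
rewrite subr0 mulr1.
case/andP: (a01) => a0 a1; case/andP: mu01 => mu0 mu1.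
have e0 : 0 <= delta * (1 - alpha) by rewrite mulr_ge0 ?subr_ge0 // ltW.
have xmono k m : (k + m <= N)%N -> F (x k) <= F (x (k + m)%N).
  elim: m => [|m IH] kmN; first by rewrite addn0.
  have kmN' : (k + m <= N)%N by lia.
  apply: le_trans (IH kmN') _; rewrite addnS.
  apply: multilinear_ext_homo => //.
  - move=> j; rewrite !mxE mulr_ge0 //.
    by have /andP[] := Pcube _ (Pvmax _ (Px _ kmN')) j.
  - exact/Pcube/Px.
  - by apply/Pcube/(Px (k + m).+1); rewrite -addnS.
have nR4 : 4 <= n%:R :> R by rewrite (ler_nat R 4 n).
have dn3 : delta * n%:R ^+ 3 <= 1.
  have n3 : 0 < (n ^ 3)%:R :> R by rewrite ltr0n expn_gt0; lia.
  by move: dn; rewrite ler_pdivlMr // natrX; lra.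
have dn1 : 16 * (n%:R * delta) <= 1.
  apply: le_trans dn3; have -> : delta * n%:R ^+ 3 = n%:R ^+ 2 * (n%:R * delta).
    by ring.
  rewrite ler_wpM2r //; first by rewrite mulr_ge0 // ltW.
  by nra.
have nd4 : 4 * delta <= n%:R * delta by rewrite ler_wpM2r // ltW.
have p01 : 0 <= 3 * delta <= 1 by lra.
(* Since [n * delta <= 1 / 16], Bernoulli gives at least [1 - 3 / 16]. *)
have c34 : 3 / 4 <= (1 - 3 * delta) ^+ n.
  by apply: le_trans (bernoulli_le _ n p01); lra.
have OPTge y : P y -> F y <= OPT by rewrite -optE; exact: optP.
have OPT0 : 0 <= OPT.
  by rewrite -optE; apply: multilinear_ext_ge0 => //; exact: Pcube.
(* The contraction rate: [3 / 4] from the shrinking weights, [delta * (1 - alpha)] from the step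
   length, [mu] from the [mu] bound. *)
pose r := 3 / 4 * (delta * (1 - alpha) * mu).
have r0 : 0 <= r by rewrite !mulr_ge0 // ?subr_ge0 ltW.
have r1 : r <= 1.
  have le1 : delta * (1 - alpha) <= 1 by apply: mulr_ile1; lra.
  have : delta * (1 - alpha) * mu <= 1 by apply: mulr_ile1; lra.
  by rewrite /r; lra.
have contract k : (3 * k <= 2 * N)%N -> (k < N)%N ->
    OPT - F (x k.+1) <= (1 - r) * (OPT - F (x k)).
  move=> k23 kN; have [Pk vk uk] := xP k (ltnW kN).
  have kd : 3 * (k%:R * delta) <= 2.
    move: k23; rewrite -(ler_nat R) !natrM => /(ler_wpM2r (ltW d0)).
    by move: Nd; lra.
  have gain : (1 - 3 * delta) ^+ n *
      (delta * (1 - alpha) * dot (vmax (x k)) (grad F (x k)))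
      <= F (x k.+1) - F (x k).
    apply: multilinear_ext_step => //; try exact/Pcube/Pvmax; try exact: Pcube.
      exact/Pcube/(Px k.+1).
    (* Time is at most [2 / 3], so [1 - x k 0 j >= (1 - alpha) / 3]; hence the step length
       [delta * (1 - alpha)] is at most [3 * delta * (1 - x k 0 j)], whence [p = 3 * delta]. *)
    move=> j; have := uk j; rewrite -/x => ukj.
    have A : (1 - alpha) * (1 - k%:R * delta) <= 1 - x k 0 j by lra.
    have B : 1 - alpha <= 3 * (1 - x k 0 j).
      have : 0 <= (1 - alpha) * (2 - 3 * (k%:R * delta)).
        by rewrite mulr_ge0 // subr_ge0 // ltW.
      by lra.
    by have := ler_wpM2l (ltW d0) B; lra.
  have G0 : 0 <= OPT - F (x k) by rewrite subr_ge0 OPTge.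
  have mG0 : 0 <= mu * (OPT - F (x k)) by rewrite mulr_ge0 // ltW.
  have M := ler_wpM2l e0 (muP _ Pk vk).
  have eG0 := mulr_ge0 e0 mG0.
  have c0 : 0 <= (3 / 4 : R) by lra.
  have Q := ler_pM c0 eG0 c34 M.
  by move: (le_trans Q gain); rewrite /r; lra.
have gap K : (3 * K <= 2 * N + 2)%N -> (K <= N)%N ->
    OPT - F (x K) <= (1 - r) ^+ K * OPT.
  elim: K => [_ _|K IH K23 KN].
    (* The initial gap is at most [OPT] because [F] is non-negative at the starting point. *)
    by rewrite expr0 mul1r gerBl; apply/multilinear_ext_ge0 => //; exact/Pcube/Px.
  have [K23' K23''] : (3 * K <= 2 * N)%N /\ (3 * K <= 2 * N + 2)%N.
    by clear -K23; split; lia.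
  apply: le_trans (contract K K23' KN) _.
  by rewrite exprS -mulrA ler_wpM2l ?subr_ge0 // IH // ltnW.
have Ngt : (1 < N)%N.
  rewrite -(ltr_nat R) -(ltr_pM2r d0) Nd.
  by lra.
(* The ceiling of [2 * N / 3]: the first index at time at least [2 / 3]. The last contracting step
   then still starts before time [2 / 3]. *)
pose K := ((2 * N + 2) %/ 3)%N.
have K1 : (3 * K <= 2 * N + 2)%N by clear; rewrite /K; lia.
have K2 : (2 * N <= 3 * K)%N by clear; rewrite /K; lia.
have K3 : (K <= N)%N by clear -Ngt; rewrite /K; lia.
have xKN : F (x K) <= F (x N).
  by have := xmono K (N - K)%N; rewrite subnKC //; apply.
(* From [1 - r <= expR (- r)] and [K * delta >= 2 / 3]; the exponent's [1 / 2] is [3 / 4] times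
   [2 / 3]. *)
have rK : (1 - r) ^+ K <= expR (- (2^-1 * (1 - alpha) * mu)).
  apply: (@le_trans _ _ (expR (- r) ^+ K)).
    apply: lerXn2r; rewrite ?nnegrE ?subr_ge0 ?expR_ge0 //.
    exact: expR_ge1Dx.
  rewrite -expRM_natl ler_expR.
  have kd : 2 <= 3 * (K%:R * delta).
    move: K2; rewrite -(ler_nat R) !natrM => /(ler_wpM2r (ltW d0)).
    by move: Nd; lra.
  have am : 0 <= (1 - alpha) * mu by rewrite mulr_ge0 ?subr_ge0 // ltW.
  by have := ler_wpM2r am kd; rewrite /r; lra.
have := gap K K1 K3; have := ler_wpM2r OPT0 rK.
by move: xKN; lra.
Unshelve. all: by end_near. Qed.
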